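(* There is no distance-regular graph with any of the intersection arrays $\{83,54,21;1,6,63\}$, $\{104,70,25;1,7,80\}$, $\{195,160,28;1,20,168\}$, $\{125,108,24;1,9,75\}$, $\{126,90,10;1,6,105\}$, $\{203,160,34;1,16,170\}$, or $\{53,40,28,16;1,4,10,28\}$.
   Context: A connected graph $\Gamma$ of diameter $D$ is distance-regular if for any vertices $x,y$ at distance $i$ the numbers $b_i$ of neighbours of $y$ at distance $i+1$ from $x$ and $c_i$ of neighbours of $y$ at distance $i-1$ from $x$ depend only on $i$; its intersection array is $\{b_0,b_1,\dots,b_{D-1};c_1,c_2,\dots,c_D\}$. *)

(* Defs.v *)
From mathcomp Require Import all_boot.

Set Implicit Arguments.
Unset Strict Implicit.
Unset Printing Implicit Defensive.

Section Graph.

Variables (T : finType) (e : rel T).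

Definition simple_graph : Prop := symmetric e /\ irreflexive e.

Definition connected_graph : Prop :=
  0 < #|T| /\ forall x y : T, connect e x y.

Definition has_walk (x y : T) (n : nat) : bool :=
  [exists p : n.-tuple T, path e x p && (last x p == y)].

(* The least length of a walk from x to y; when y is reachable from x this is *)
(* less than #|T|, and #|T| is the junk value when it is not.                 *)
Definition gdist (x y : T) : nat := find (has_walk x y) (iota 0 #|T|).

Definition diameter : nat := \max_(x : T) \max_(y : T) gdist x y.

Definition nb_further (x y : T) : nat :=
  #|[set z | e y z && (gdist x z == (gdist x y).+1)]|.

(* Written with the successor on the left so that no truncated predecessor    *)
(* occurs: the count is 0 when x = y.                                         *)
Definition nb_closer (x y : T) : nat :=
  #|[set z | e y z && ((gdist x z).+1 == gdist x y)]|.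

Definition distance_regular : Prop :=
  [/\ simple_graph, connected_graph
    & exists b c : nat -> nat, forall x y : T,
        nb_further x y = b (gdist x y) /\ nb_closer x y = c (gdist x y)].

(* The array {b_0, ..., b_(D-1); c_1, ..., c_D} is the pair of sequences      *)
(* ([:: b_0; ...; b_(D-1)], [:: c_1; ...; c_D]), so c_i sits at index i.-1.   *)
Definition has_intersection_array (a : seq nat * seq nat) : Prop :=
  [/\ size a.1 = diameter, size a.2 = diameter
    & forall x y : T,
        (gdist x y < diameter -> nb_further x y = nth 0 a.1 (gdist x y)) /\
        (0 < gdist x y -> nb_closer x y = nth 0 a.2 (gdist x y).-1)].

End Graph.

(* Main.v *)
Require Import Defs.
From Stdlib Require Import ZArith.
From mathcomp Require Import all_boot all_order ssralg ssrnum.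
From mathcomp Require Import ssrZ zify ring.

(**
Distances in a distance-regular graph form an association scheme, whose
intersection numbers are determined by the array through the three-term
relation A A_i = b_(i-1) A_(i-1) + a_i A_i + c_(i+1) A_(i+1). If the Krein
parameter q^h_ij vanishes, the triple intersection numbers
[r s t] = #{z | d u z = r, d v z = s, d w z = t} satisfy, for all u, v, w,
  sum_(r, s, t) Q_ri Q_sj Q_th [r s t] = 0.
Together with their marginals, which are intersection numbers, this leaves no
admissible values of [r s t] for a suitable choice of the distances between
u, v, w, except for the array {104,70,25;1,7,80}. There, if u, v, w are pairwise
adjacent, w has at least 17 neighbours at distances 1 and 2 from u and v, while
each such vertex has at most 6 neighbours adjacent to both u and v; counting
edges gives 33 * 17 <= 70 * 6, which is false.
*)

Set Implicit Arguments.
Unset Strict Implicit.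
Unset Printing Implicit Defensive.

Import Order.TTheory GRing.Theory Num.Theory.

(** * The path metric of a connected graph *)

Section GraphDistance.

Variables (T : finType) (e : rel T).
Hypotheses (e_sym : symmetric e) (e_irr : irreflexive e).
Hypothesis e_conn : forall x y : T, connect e x y.

Local Notation d := (gdist e).

Lemma has_walkP x y n :
  reflect (exists p, [/\ size p = n, path e x p & last x p = y])
          (has_walk e x y n).
Proof.
apply: (iffP existsP) => [[p /andP[ep /eqP lp]] | [p [<- ep lp]]].
  by exists p; rewrite size_tuple.
by exists (in_tuple p); rewrite ep lp eqxx.
Qed.

(** A duplicate-free path has fewer edges than there are vertices, so on a connected graph the
    search in [gdist] always succeeds. *)
Lemma gdist_lt_card x y : d x y < #|T|.
Proof.
rewrite /gdist -[X in _ < X](size_iota 0) -has_find.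
have [p ep ->] := connectP (e_conn x y).
have [q eq uq _] := shortenP ep.
apply/hasP; exists (size q); last by apply/has_walkP; exists q.
by rewrite mem_iota /= add0n -[(size q).+1](card_uniqP uq) max_card.
Qed.

Lemma gdist_walk x y :
  exists p, [/\ size p = d x y, path e x p & last x p = y].
Proof.
have dlt := gdist_lt_card x y.
apply/has_walkP; rewrite -[X in has_walk _ _ _ X]add0n -(nth_iota 0 0 dlt).
by apply: nth_find; rewrite has_find size_iota.
Qed.

Lemma gdist_le x p : path e x p -> d x (last x p) <= size p.
Proof.
move=> ep; have dlt := gdist_lt_card x (last x p).
rewrite leqNgt; apply/negP => plt.
have := before_find 0 plt; rewrite nth_iota ?(ltn_trans plt) // add0n.
by case/has_walkP; exists p.
Qed.

Lemma gdist0 x y : (d x y == 0) = (x == y).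
Proof.
apply/eqP/eqP => [d0 | <-].
  by have [p [sp _ <-]] := gdist_walk x y; case: p sp; rewrite d0.
by apply/eqP; rewrite -leqn0 (@gdist_le x [::]).
Qed.

Lemma gdist_sym x y : d x y = d y x.
Proof.
suff le z t : d z t <= d t z by apply/eqP; rewrite eqn_leq !le.
have [p [<- ep <-]] := gdist_walk t z.
have := @gdist_le (last t p) (rev (belast t p)).
rewrite size_rev size_belast rev_path (eq_path (e' := e)) //.
move=> /(_ ep); case: p {ep} => [|s p] //=.
by rewrite rev_cons last_rcons.
Qed.

Lemma gdist_edge x y z : e y z -> d x z <= (d x y).+1.
Proof.
move=> eyz; have [p [<- ep lp]] := gdist_walk x y.
have := @gdist_le x (rcons p z).
by rewrite last_rcons size_rcons rcons_path ep lp => /(_ eyz).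
Qed.

Lemma gdist1 x y : (d x y == 1) = e x y.
Proof.
apply/eqP/idP => [d1 | exy].
  have [p [sp ep <-]] := gdist_walk x y; case: p sp ep; rewrite d1 //.
  by move=> z [] //= _; rewrite andbT.
apply/eqP; rewrite eqn_leq (@gdist_le x [:: y]) /= ?exy // lt0n gdist0.
by apply/eqP => xy; rewrite xy e_irr in exy.
Qed.

Lemma gdist_le_diameter x y : d x y <= diameter e.
Proof.
apply: leq_trans (leq_bigmax x); apply: (leq_bigmax (F := fun z => d x z)).
Qed.

End GraphDistance.

(** * Intersection numbers and Krein conditions computed from the array *)

Section IntersectionNumbers.

Local Open Scope ring_scope.

(* Unlike big operators, which are locked, these sums evaluate.               *)
Fixpoint psum (n : nat) (F : nat -> Z) : Z :=
  (if n is m.+1 then psum m F + F m else 0)%R.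

Lemma psumS n F : psum n.+1 F = psum n F + F n.
Proof. by []. Qed.

Lemma psumE n F : psum n F = \sum_(i < n) F i.
Proof. by elim: n => [|n IHn]; rewrite ?big_ord0 // big_ord_recr psumS IHn. Qed.

Definition delta (i j : nat) : Z := (if i == j then 1 else 0)%R.

Lemma psum_delta n (f : nat -> Z) j :
  (j < n)%N -> psum n (fun i => f i * delta i j) = f j.
Proof.
elim: n => // n IHn; rewrite psumS ltnS leq_eqVlt => /orP[/eqP-> | jn].
  rewrite psumE big1 => [|i _]; first by rewrite /delta eqxx add0r mulr1.
  by rewrite /delta ltn_eqF ?mulr0 ?ltn_ord.
by rewrite IHn // /delta gtn_eqF ?mulr0 ?addr0.
Qed.

Variables bs cs : seq nat.

Definition bnum i : Z := Z.of_nat (nth 0%N bs i).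
Definition cnum i : Z := Z.of_nat (nth 0%N (0%N :: cs) i).
Definition anum i : Z := (bnum 0 - bnum i - cnum i)%R.

(** The effect of the adjacency matrix on the matrix with entries [f (d x y)]. Written as
    corrections to the degree times [f h], it needs no boundary cases: [bnum] defaults to 0 at the
    diameter, and [h.-1 = h] at [h = 0]. *)
Definition neighbour_sum (f : nat -> Z) (h : nat) : Z :=
  (bnum 0 * f h + bnum h * (f h.+1 - f h) + cnum h * (f h.-1 - f h))%R.

Definition three_term (u : nat -> Z) (i : nat) : Z :=
  (cnum i.+1 * u i.+1 + anum i * u i +
   if i is i'.+1 then bnum i' * u i' else 0)%R.

Lemma neighbour_sum_delta i h :
  neighbour_sum (delta i) h = three_term (fun m => delta m h) i.
Proof.
rewrite /neighbour_sum /three_term /anum /delta.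
have c0 : cnum 0 = 0 by [].
by case: h i => [|h] [|i]; rewrite ?c0 ?eqSS /=; do ?[case: eqP => ?];
  subst => //; lia.
Qed.

(* [inum i j h] is p^h_ij. Solving the three-term relation for its leading    *)
(* term makes the division exact, which is what [intersection_exact] tests.   *)
Fixpoint inum (i j h : nat) : Z :=
  (if i is i'.+1 then
     Z.div (three_term (fun m => inum i' m h) j - anum i' * inum i' j h
             - if i' is i''.+1 then bnum i'' * inum i'' j h else 0)%R
           (cnum i)
   else delta j h)%R.

Definition intersection_exact : bool :=
  all (fun i => (cnum i.+1 != 0) &&
    all (fun j => all (fun h =>
      three_term (fun m => inum m j h) i == three_term (fun m => inum i m h) j)
    (iota 0 (size bs).+1)) (iota 0 (size bs).+1)) (iota 0 (size bs)).

Definition conv_value (f g : nat -> Z) (h : nat) : Z :=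
  psum (size bs).+1 (fun i =>
    psum (size bs).+1 (fun j => f i * g j * inum i j h)%R).

(* Up to scaling, the matrix with entries [f (d x y)] is idempotent.          *)
Definition reproducing (f : nat -> Z) : bool :=
  (f 0%N != 0) &&
  all (fun h => conv_value f f h * f 0%N == conv_value f f 0 * f h)
      (iota 0 (size bs).+1).

(** As [inum i i 0] is the valency k_i, the last sum is a row sum of the Schur product of three
    multiples of idempotents, hence a nonzero multiple of their Krein parameter. *)
Definition krein_zero (f g h : nat -> Z) : bool :=
  [&& reproducing f, reproducing g, reproducing h
    & psum (size bs).+1 (fun i => f i * g i * h i * inum i i 0) == 0].

Lemma eq_psum n (F G : nat -> Z) :
  (forall i, (i < n)%N -> F i = G i) -> psum n F = psum n G.
Proof. by move=> FG; rewrite !psumE; apply: eq_bigr => i _; apply: FG. Qed.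

Lemma psumMl n a (F : nat -> Z) : a * psum n F = psum n (fun i => a * F i).
Proof. by rewrite !psumE mulr_sumr. Qed.

Lemma psumM3 n (F G H : nat -> Z) : psum n F * psum n G * psum n H =
  psum n (fun i => psum n (fun j => psum n (fun k => F i * G j * H k))).
Proof.
transitivity (psum n (fun i => (psum n G * psum n H) * F i)).
  by rewrite -psumMl; ring.
apply: eq_psum => i _; transitivity (psum n (fun j => (F i * psum n H) * G j)).
  by rewrite -psumMl; ring.
by apply: eq_psum => j _; rewrite -psumMl; ring.
Qed.

Lemma psum_sum (I : finType) n (F : nat -> I -> Z) :
  \sum_z psum n (F ^~ z) = psum n (fun i => \sum_z F i z).
Proof.
by rewrite psumE exchange_big; apply: eq_bigr => z _; rewrite psumE.
Qed.

Lemma sum_prod3 (I : finType) (F G H : I -> Z) :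
  \sum_(q : I * I * I) F q.1.1 * G q.1.2 * H q.2 =
  (\sum_u F u) * (\sum_v G v) * (\sum_w H w).
Proof.
rewrite big_distrlr /= pair_bigA big_distrlr /= pair_bigA.
by apply: eq_bigr => -[[u v] w].
Qed.

(* [x i j k] plays the role of #{z | d u z = i, d v z = j, d w z = k} for      *)
(* vertices with d u v = A, d u w = B, d v w = C.                             *)
Record triple_system (A B C : nat) (x : nat -> nat -> nat -> Z) : Prop := {
  ts_ge0 : forall i j k, 0 <= x i j k;
  ts_u : forall j k, x 0%N j k = delta j A * delta k B;
  ts_v : forall i k, x i 0%N k = delta i A * delta k C;
  ts_w : forall i j, x i j 0%N = delta i B * delta j C;
  ts_uv : forall i j, (i <= size bs)%N -> (j <= size bs)%N ->
    psum (size bs).+1 (fun k => x i j k) = inum i j A;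
  ts_uw : forall i k, (i <= size bs)%N -> (k <= size bs)%N ->
    psum (size bs).+1 (fun j => x i j k) = inum i k B;
  ts_vw : forall j k, (j <= size bs)%N -> (k <= size bs)%N ->
    psum (size bs).+1 (fun i => x i j k) = inum j k C;
  ts_krein : forall f g h, krein_zero f g h ->
    psum (size bs).+1 (fun i => psum (size bs).+1 (fun j => psum (size bs).+1
      (fun k => f i * g j * h k * x i j k))) = 0
}.

Lemma psum_eq0 n (F : nat -> Z) m :
  (forall i, 0 <= F i) -> psum n F = 0 -> (m < n)%N -> F m = 0.
Proof.
move=> F_ge0; rewrite psumE => /psumr_eq0P F0 mn.
by apply: (F0 _ (Ordinal mn)).
Qed.

(** Nonnegativity turns a zero marginal into the vanishing of all its entries. Recording this as
    equations lets some later cases do without the inequalities. *)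
Definition triple_void (A B C i j k : nat) : bool :=
  [&& i <= size bs, j <= size bs & k <= size bs]%N &&
  [|| inum i j A == 0, inum i k B == 0 | inum j k C == 0].

Lemma triple_voidP A B C x i j k :
  triple_system A B C x -> triple_void A B C i j k -> x i j k = 0.
Proof.
case=> ge0 _ _ _ uv uw vw _ /andP[/and3P[iD jD kD]] /or3P[] /eqP p0.
- by apply: (psum_eq0 (F := x i j) (n := (size bs).+1)); rewrite ?uv.
- by apply: (psum_eq0 (F := fun m => x i m k) (n := (size bs).+1)); rewrite ?uw.
- by apply: (psum_eq0 (F := fun m => x m j k) (n := (size bs).+1)); rewrite ?vw.
Qed.

(** * The association scheme of distances and its triple intersection numbers *)

Section Scheme.

Variables (T : finType) (d : T -> T -> nat).

Hypothesis dsym : forall x y, d x y = d y x.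
Hypothesis d0 : forall x y, (d x y == 0%N) = (x == y).
Hypothesis d_le : forall x y, (d x y <= size bs)%N.
Hypothesis d_neighbours : forall (f : nat -> Z) x y,
  \sum_(z | d y z == 1%N) f (d x z) = neighbour_sum f (d x y).
Hypothesis size_cs : size cs = size bs.
Hypothesis exact_inum : intersection_exact.

Definition conv (f g : nat -> Z) (x y : T) : Z :=
  (\sum_z f (d x z) * g (d y z))%R.

(** [conv] is a product of symmetric matrices, and the symmetric adjacency matrix can be moved from
    one factor to the other. *)
Lemma conv_neighbour_sum f g x y :
  conv (neighbour_sum f) g x y = conv f (neighbour_sum g) x y.
Proof.
rewrite /conv.
under eq_bigr do rewrite -d_neighbours mulr_suml.
under [RHS]eq_bigr do rewrite -d_neighbours mulr_sumr.
rewrite (exchange_big_dep predT) //=.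
by under eq_bigr do under eq_bigl do rewrite dsym.
Qed.

Lemma conv_three_terml (u : nat -> nat -> Z) i g x y :
  conv (fun h => three_term (u ^~ h) i) g x y =
  three_term (fun m => conv (u m) g x y) i.
Proof.
rewrite /conv /three_term; cbv beta; rewrite !mulr_sumr.
case: i => [|i]; rewrite ?addr0 ?mulr_sumr -!big_split.
all: apply: eq_bigr => z _ /=.
  lia.
lia.
Qed.

Lemma convC f g x y : conv f g x y = conv g f y x.
Proof. by apply: eq_bigr => z _; rewrite mulrC. Qed.

Lemma eq_three_term (u v : nat -> Z) i : (i <= size bs)%N ->
  (forall m, (m <= size bs)%N -> u m = v m) -> three_term u i = three_term v i.
Proof.
move=> iD uv; rewrite /three_term (uv i) //; congr (_ + _ + _); last first.
  by case: i iD => // i iD; rewrite uv // ltnW.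
case: (ltngtP i (size bs)) iD => // [iD | ->] _; first by rewrite uv.
(* At the diameter the value of [u] beyond the range is irrelevant, since its coefficient [cnum] is
   the default 0. *)
by rewrite /cnum nth_default ?mul0r //= size_cs.
Qed.

(** This is (A A_i) A_j = A_i (A A_j), with both products by A expanded by the three-term
    relation. *)
Lemma conv_delta_rec i j x y :
  three_term (fun m => conv (delta m) (delta j) x y) i =
  three_term (fun m => conv (delta i) (delta m) x y) j.
Proof.
have E k f z t : conv (neighbour_sum (delta k)) f z t =
    three_term (fun m => conv (delta m) f z t) k.
  rewrite -conv_three_terml; apply: eq_bigr => s _.
  by rewrite neighbour_sum_delta.
rewrite -E conv_neighbour_sum convC E /three_term.
by case: j => [|j]; rewrite ![conv _ (delta i) _ _]convC.
Qed.

Lemma conv_delta0 g x y : conv (delta 0) g x y = g (d x y).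
Proof.
rewrite /conv (bigD1 x) //= big1 => [|z zx].
  by rewrite /delta eq_sym d0 eqxx mul1r addr0 dsym.
by rewrite /delta eq_sym d0 eq_sym (negbTE zx) mul0r.
Qed.

(** Both sides obey the same recurrence in [i]: the left by [conv_delta_rec], the right by the
    exactness test, whose condition [cnum i.+1 != 0] allows the leading coefficient to be
    cancelled. *)
Lemma conv_delta i j x y : (i <= size bs)%N -> (j <= size bs)%N ->
  conv (delta i) (delta j) x y = inum i j (d x y).
Proof.
elim/ltn_ind: i j => -[|i] IH j iD jD; first exact: conv_delta0.
have /allP/(_ i) := exact_inum; rewrite mem_iota => /(_ iD)/andP[ci].
move=> /allP/(_ j); rewrite mem_iota => /(_ jD).
move=> /allP/(_ (d x y)); rewrite mem_iota => /(_ (d_le x y))/eqP.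
have := conv_delta_rec i j x y.
rewrite [RHS](eq_three_term (v := fun m => inum i m (d x y))) //; last first.
  by move=> m mD; apply: IH => //; apply: ltnW.
move=> <-; rewrite /three_term (IH i) // 1?ltnW //.
case: i IH iD ci => [|i] IH iD ci.
  by move=> /addIr/addIr/(mulfI ci) ->.
by rewrite (IH i) // 1?ltnW // 1?ltnW // => /addIr/addIr/(mulfI ci) ->.
Qed.

Lemma conv_valueP f g x y : conv f g x y = conv_value f g (d x y).
Proof.
have dlt z t : (d z t < (size bs).+1)%N by rewrite ltnS.
rewrite /conv /conv_value.
transitivity (\sum_z psum (size bs).+1 (fun i => psum (size bs).+1 (fun j =>
    f i * g j * (delta i (d x z) * delta j (d y z))))).
  apply: eq_bigr => z _.
  rewrite -(psum_delta f (dlt x z)) -(psum_delta g (dlt y z)) mulrC psumMl.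
  apply: eq_psum => i _; rewrite mulrC psumMl; apply: eq_psum => j _.
  by ring.
rewrite psum_sum; apply: eq_psum => i iD.
rewrite psum_sum; apply: eq_psum => j jD.
by rewrite -mulr_sumr -conv_delta.
Qed.

Lemma reproducingP f x y : reproducing f ->
  conv f f x y * f 0%N = conv_value f f 0 * f (d x y).
Proof.
move=> /andP[_ /allP/(_ (d x y))]; rewrite mem_iota => /(_ (d_le x y))/eqP.
by rewrite conv_valueP.
Qed.

(* The sum over all [u, v, w] of the squares of the left-hand sides is, by    *)
(* idempotence, a multiple of the entry sum of the Schur product of the three *)
(* matrices, which the vanishing Krein parameter makes zero.                  *)
Lemma krein_zero_triple f g h u v w : krein_zero f g h ->
  \sum_z f (d u z) * g (d v z) * h (d w z) = 0.
Proof.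
case/and4P => rf rg rh /eqP kr0.
pose G (q : T * T * T) z := f (d q.1.1 z) * g (d q.1.2 z) * h (d q.2 z).
suff S0 : \sum_q (\sum_z G q z) ^+ 2 = 0.
  have /eqP := S0; rewrite psumr_eq0 => [|q _]; last exact: sqr_ge0.
  move=> /allP/(_ (u, v, w)); rewrite mem_index_enum sqrf_eq0.
  by move=> /(_ isT)/eqP.
have schur0 y : \sum_z f (d y z) * g (d y z) * h (d y z) = 0.
  rewrite -[RHS]kr0.
  have dlt z t : (d z t < (size bs).+1)%N by rewrite ltnS.
  transitivity (\sum_z psum (size bs).+1 (fun i =>
      f i * g i * h i * delta i (d y z))).
    apply: eq_bigr => z _.
    by rewrite (psum_delta (fun i => f i * g i * h i)).
  rewrite psum_sum; apply: eq_psum => i iD; rewrite -mulr_sumr; congr (_ * _).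
  have dyy : d y y = 0%N by apply/eqP; rewrite d0.
  rewrite -dyy -conv_delta //; apply: eq_bigr => z _.
  by rewrite /delta; case: eqP; rewrite ?mulr1 ?mulr0.
have [/andP[f0 _] /andP[g0 _] /andP[h0 _]] := And3 rf rg rh.
(* The nonzero factors [f 0], [g 0], [h 0] are inserted because [reproducing] states idempotence
   over the integers without division. *)
apply/eqP; rewrite -(mulIr_eq0 _ (mulIf f0)) -(mulIr_eq0 _ (mulIf g0)).
rewrite -(mulIr_eq0 _ (mulIf h0)); apply/eqP.
(* Expanding the square brings in a second vertex y. Summing over u, v, w first leaves a product of
   three (y, z) entries of matrix squares. *)
under eq_bigr do rewrite expr2 big_distrlr /=.
rewrite exchange_big /=; under eq_bigr do rewrite exchange_big /=.
rewrite !mulr_suml; apply: big1 => y _.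
set c := conv_value f f 0 * conv_value g g 0 * conv_value h h 0.
transitivity (\sum_z c * (f (d y z) * g (d y z) * h (d y z))); last first.
  by rewrite -mulr_sumr schur0 mulr0.
rewrite !mulr_suml; apply: eq_bigr => z _.
have E k : \sum_t k (d t y) * k (d t z) = conv k k y z.
  by apply: eq_bigr => t _; rewrite ![d t _]dsym.
transitivity ((conv f f y z * f 0%N) * (conv g g y z * g 0%N) *
  (conv h h y z * h 0%N)); last by rewrite !reproducingP // /c; ring.
rewrite -!E.
transitivity (((\sum_t f (d t y) * f (d t z)) * (\sum_t g (d t y) * g (d t z)) *
   (\sum_t h (d t y) * h (d t z))) * f 0%N * g 0%N * h 0%N); last by ring.
rewrite -sum_prod3; do 3!congr (_ * _).
by apply: eq_bigr => q _; rewrite /G; ring.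
Qed.

Definition triple (u v w : T) (i j k : nat) : Z :=
  (\sum_z delta i (d u z) * delta j (d v z) * delta k (d w z))%R.

Lemma triple_ge0 u v w i j k : 0 <= triple u v w i j k.
Proof.
apply: sumr_ge0 => z _; rewrite /delta.
by do 3?case: eqP => _; rewrite ?mulr0 ?mul0r ?mulr1.
Qed.

Lemma triple_swap12 u v w i j k : triple u v w i j k = triple v u w j i k.
Proof. by apply: eq_bigr => z _; ring. Qed.

Lemma triple_swap23 u v w i j k : triple u v w i j k = triple u w v i k j.
Proof. by apply: eq_bigr => z _; ring. Qed.

Lemma psum_delta1 n j : (j < n)%N -> psum n (delta ^~ j) = 1.
Proof.
move=> jn; rewrite -[RHS](psum_delta (fun _ => 1) jn).
by apply: eq_psum => i _; rewrite mul1r.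
Qed.

Lemma triple_marginal u v w i j : (i <= size bs)%N -> (j <= size bs)%N ->
  psum (size bs).+1 (triple u v w i j) = inum i j (d u v).
Proof.
move=> iD jD; rewrite -psum_sum -conv_delta //; apply: eq_bigr => z _.
by rewrite -psumMl psum_delta1 ?mulr1 // ltnS.
Qed.

Lemma triple_base u v w j k :
  triple u v w 0 j k = delta j (d u v) * delta k (d u w).
Proof.
rewrite /triple (bigD1 u) //= big1 => [|z zu].
  by rewrite {1}/delta eq_sym d0 eqxx mul1r addr0 ![d _ u]dsym.
by rewrite {1}/delta eq_sym d0 eq_sym (negbTE zu) !mul0r.
Qed.

Lemma triple_krein f g h u v w : krein_zero f g h ->
  psum (size bs).+1 (fun i => psum (size bs).+1 (fun j => psum (size bs).+1
    (fun k => f i * g j * h k * triple u v w i j k))) = 0.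
Proof.
move=> /(krein_zero_triple u v w) <-.
have dlt z t : (d z t < (size bs).+1)%N by rewrite ltnS.
transitivity (\sum_z psum (size bs).+1 (fun i => psum (size bs).+1 (fun j =>
    psum (size bs).+1 (fun k => f i * g j * h k *
      (delta i (d u z) * delta j (d v z) * delta k (d w z)))))).
  rewrite psum_sum; apply: eq_psum => i _; rewrite psum_sum.
  apply: eq_psum => j _; rewrite psum_sum; apply: eq_psum => k _.
  by rewrite -mulr_sumr.
apply: eq_bigr => z _.
rewrite -(psum_delta f (dlt u z)) -(psum_delta g (dlt v z)).
rewrite -(psum_delta h (dlt w z)) psumM3; apply: eq_psum => i _.
by apply: eq_psum => j _; apply: eq_psum => k _; ring.
Qed.

Lemma sphere_pair A B x y : (A <= size bs)%N -> (B <= size bs)%N ->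
  0 < inum A B (d x y) -> exists z, d x z = A /\ d y z = B.
Proof.
move=> AD BD; rewrite -conv_delta // => N_gt0.
have [/existsP[z /andP[/eqP <- /eqP <-]] | none] :=
  boolP [exists z, (d x z == A) && (d y z == B)]; first by exists z.
move: N_gt0; rewrite /conv big1 ?ltxx // => z _.
have := existsPn none z; rewrite negb_and /delta ![_ == d _ z]eq_sym.
by case/orP => /negbTE ->; rewrite ?mul0r ?mulr0.
Qed.

Lemma tripleP u v w :
  triple_system (d u v) (d u w) (d v w) (triple u v w).
Proof.
split=> [i j k | j k | i k | i j | i j iD jD | i k iD kD | j k jD kD | f g h].
- exact: triple_ge0.
- exact: triple_base.
- by rewrite triple_swap12 triple_base dsym.
- by rewrite triple_swap23 triple_swap12 triple_base ![d w _]dsym.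
- exact: triple_marginal.
- rewrite -(triple_marginal u w v iD kD).
  by apply: eq_psum => j _; rewrite triple_swap23.
- rewrite -(triple_marginal v w u jD kD).
  by apply: eq_psum => i _; rewrite triple_swap12 triple_swap23.
- exact: triple_krein.
Qed.

Lemma exists_triple_system (u : T) A B C :
  (A <= size bs)%N -> (B <= size bs)%N -> (C <= size bs)%N ->
  0 < inum A A 0 -> 0 < inum B C A -> exists x, triple_system A B C x.
Proof.
move=> AD BD CD; have /eqP <- : d u u == 0%N by rewrite d0.
move=> /(sphere_pair AD AD)[v [<- _]] /(sphere_pair BD CD)[w [<- <-]].
by exists (triple u v w); apply: tripleP.
Qed.

(* Both sides count the pairs (w, z) with d w z = k.                          *)
Lemma triple_exchange u v i j i' j' k :
  \sum_w delta i (d u w) * delta j (d v w) * triple u v w i' j' k =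
  \sum_z delta i' (d u z) * delta j' (d v z) * triple u v z i j k.
Proof.
under eq_bigr do rewrite mulr_sumr; rewrite exchange_big /=.
apply: eq_bigr => z _; rewrite mulr_sumr; apply: eq_bigr => w _.
by rewrite (dsym w z); ring.
Qed.

Lemma triple_double_count (u : T) A i j i' j' k (l m : Z) :
  all (leq^~ (size bs)) [:: A; i; j; i'; j'] -> 0 < inum A A 0 ->
  (forall x, triple_system A i j x -> l <= x i' j' k) ->
  (forall x, triple_system A i' j' x -> x i j k <= m) ->
  l * inum i j A <= m * inum i' j' A.
Proof.
case/and5P => AD iD jD i'D /andP[j'D _].
have /eqP <- : d u u == 0%N by rewrite d0.
move=> /(sphere_pair AD AD)[v [<- _]] lb ub.
rewrite -!conv_delta // !mulr_sumr.
apply: (@le_trans _ _ (\sum_w delta i (d u w) * delta j (d v w)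
    * triple u v w i' j' k)); last rewrite triple_exchange.
  apply: ler_sum => w _; rewrite /delta.
  case: eqP => [iw|_]; case: eqP => [jw|_]; rewrite ?mul0r ?mulr0 ?mul0r //.
  by rewrite !mul1r !mulr1 lb // iw jw; apply: tripleP.
apply: ler_sum => w _; rewrite /delta.
case: eqP => [iw|_]; case: eqP => [jw|_]; rewrite ?mul0r ?mulr0 ?mul0r //.
by rewrite !mul1r !mulr1 ub // iw jw; apply: tripleP.
Qed.

End Scheme.

End IntersectionNumbers.


(** * From a distance-regular graph to the abstract scheme *)

Section IntersectionArray.

Local Open Scope ring_scope.

Variables (T : finType) (e : rel T) (bs cs : seq nat).
Hypotheses (dr : distance_regular e) (ha : has_intersection_array e (bs, cs)).

Let e_sym : symmetric e. Proof. by case: dr => -[]. Qed.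
Let e_irr : irreflexive e. Proof. by case: dr => -[]. Qed.
Let e_conn x y : connect e x y. Proof. by case: dr => _ [_ /(_ x y)]. Qed.

Local Notation d := (gdist e).

Lemma array_gdist_le x y : (d x y <= size bs)%N.
Proof. by have [-> _ _] := ha; apply: gdist_le_diameter. Qed.

Lemma array_further x y : nb_further e x y = nth 0%N bs (d x y).
Proof.
have [/= sbs _ /(_ x y)[further _]] := ha; have := array_gdist_le x y.
rewrite leq_eqVlt => /orP[/eqP dxy | lt]; last by rewrite further // -sbs.
(* At the diameter the array has no entry; the default 0 is right because no vertex is farther
   away. *)
rewrite dxy nth_default // /nb_further; apply/eqP; rewrite cards_eq0.
apply/eqP/setP => z; rewrite !inE dxy; apply/negP => /andP[_ /eqP dxz].
by have := array_gdist_le x z; rewrite dxz ltnn.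
Qed.

Lemma array_closer x y : nb_closer e x y = nth 0%N (0%N :: cs) (d x y).
Proof.
have [_ _ /(_ x y)[_ closer]] := ha.
case dxy: (d x y) closer => [|h] closer; last by rewrite closer.
by rewrite /nb_closer dxy; apply/eqP; rewrite cards_eq0; apply/eqP/setP => z;
  rewrite !inE andbF.
Qed.

Lemma array_degree y : #|[set z | e y z]| = nth 0%N bs 0.
Proof.
have dyy : d y y = 0%N by apply/eqP; rewrite gdist0.
have := array_further y y; rewrite dyy => <-; apply: eq_card => z.
by rewrite !inE dyy gdist1 // andbb.
Qed.

Lemma sum_set_const (P : pred T) (c : Z) :
  \sum_(z | P z) c = Z.of_nat #|[set z | P z]| * c.
Proof.
transitivity (\sum_(z in [set z | P z]) c).
  by apply: eq_bigl => z; rewrite inE.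
by rewrite sumr_const; lia.
Qed.

Lemma array_neighbours (f : nat -> Z) x y :
  \sum_(z | d y z == 1%N) f (d x z) = neighbour_sum bs cs f (d x y).
Proof.
set h := d x y.
(* Adjacent vertices differ by at most 1 in distance from x, so two corrections to [f h] suffice. *)
transitivity (\sum_(z | e y z) (f h
    + (if d x z == h.+1 then f h.+1 - f h else 0)
    + (if (d x z).+1 == h then f h.-1 - f h else 0))).
  apply: eq_big => [z | z]; rewrite gdist1 // => eyz.
  have := gdist_edge e_conn x eyz; rewrite -/h.
  rewrite e_sym in eyz; have := gdist_edge e_conn x eyz; rewrite -/h.
  case: eqP => [-> | ne] le1 le2; first by rewrite gtn_eqF // addr0 subrKC.
  case: eqP => [<- | ne']; first by rewrite addr0 subrKC.
  by rewrite !addr0; congr f; lia.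
rewrite !big_split -!big_mkcondr !sum_set_const array_degree.
by rewrite -/(nb_further e x y) -/(nb_closer e x y) array_further array_closer.
Qed.

Lemma array_size : size cs = size bs.
Proof. by have [/= -> ->] := ha. Qed.

Lemma array_triple_system A B C : intersection_exact bs cs ->
  [&& A <= size bs, B <= size bs & C <= size bs]%N ->
  0 < inum bs cs A A 0 -> 0 < inum bs cs B C A ->
  exists x, triple_system bs cs A B C x.
Proof.
move=> ex /and3P[AD BD CD]; have [_ [/card_gt0P[u _] _] _] := dr.
apply: (exists_triple_system _ _ _ _ array_size ex u) => //.
- exact: gdist_sym.
- exact: gdist0.
- exact: array_gdist_le.
- exact: array_neighbours.
Qed.

Lemma array_double_count A i j i' j' k (l m : Z) :
  intersection_exact bs cs ->
  all (leq^~ (size bs)) [:: A; i; j; i'; j'] -> 0 < inum bs cs A A 0 ->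
  (forall x, triple_system bs cs A i j x -> l <= x i' j' k) ->
  (forall x, triple_system bs cs A i' j' x -> x i j k <= m) ->
  l * inum bs cs i j A <= m * inum bs cs i' j' A.
Proof.
move=> ex; have [_ [/card_gt0P[u _] _] _] := dr.
apply: (triple_double_count _ _ _ _ array_size ex u).
- exact: gdist_sym.
- exact: gdist0.
- exact: array_gdist_le.
- exact: array_neighbours.
Qed.

End IntersectionArray.

(** * Linear integer arithmetic on triple systems, array by array *)

Section TripleCases.

Local Open Scope Z_scope.

Variable x : nat -> nat -> nat -> Z.

Ltac upto n tac := match n with O => tac n | S ?m => upto m tac; tac n end.

Ltac evaluate E :=
  match type of E with _ = ?r =>
    let v := eval vm_compute in r in change r with v in E
  end; cbn [psum size nth] in E; move: E.

Ltac triple_relations H n :=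
  match type of H with triple_system ?bs ?cs ?A ?B ?C _ =>
  upto n ltac:(fun i => upto n ltac:(fun j =>
    let E := fresh in
    have E := ts_u H i j; evaluate E;
    have E := ts_v H i j; evaluate E;
    have E := ts_w H i j; evaluate E;
    have E := ts_uv H (i := i) (j := j) isT isT; evaluate E;
    have E := ts_uw H (i := i) (k := j) isT isT; evaluate E;
    have E := ts_vw H (j := i) (k := j) isT isT; evaluate E;
    upto n ltac:(fun k =>
      let void := eval vm_compute in (triple_void bs cs A B C i j k) in
      match void with
      | true => have : x i j k = 0 by apply: (triple_voidP H); vm_compute
      | false => idtac
      end)))
  end.

Ltac triple_nonneg H n :=
  upto n ltac:(fun i => upto n ltac:(fun j => upto n ltac:(fun k =>
    move: (ts_ge0 H i j k)))).

(* The lists [f], [g], [h] below are columns of the second eigenmatrix, up to *)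
(* scaling.                                                                   *)
Ltac krein_relation H f g h :=
  let E := fresh in
  match type of H with triple_system ?bs ?cs _ _ _ _ =>
    have E : krein_zero bs cs (nth 0 f) (nth 0 g) (nth 0 h) by vm_compute
  end;
  move/(ts_krein H) in E; evaluate E.

Lemma no_triple_83 : ~ triple_system [:: 83; 54; 21]%N [:: 1; 6; 63]%N 1 1 2 x.
Proof.
move=> H; triple_relations H 3%N; triple_nonneg H 3%N.
(* The second entry over the first is an eigenvalue over the degree: the columns belong to 29, 29
   and -7. *)
krein_relation H [:: 83; 29; -1; -7] [:: 83; 29; -1; -7] [:: 83; -7; 3; -7].
lia.
Qed.

Lemma triple_111_104 :
  triple_system [:: 104; 70; 25]%N [:: 1; 7; 80]%N 1 1 1 x ->
  (17 <= x 1 2 1)%R.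
Proof.
move=> H; triple_relations H 3%N; triple_nonneg H 3%N.
krein_relation H [:: 104; 34; -1; -8] [:: 104; 34; -1; -8] [:: 65; -5; 2; -5].
lia.
Qed.

(** The vertices v and w have c_2 = 7 common neighbours, one of which is u itself. *)
Lemma triple_112_104 :
  triple_system [:: 104; 70; 25]%N [:: 1; 7; 80]%N 1 1 2 x ->
  (x 1 1 1 <= 6)%R.
Proof.
move=> H; triple_relations H 3%N; triple_nonneg H 3%N.
lia.
Qed.

Lemma no_triple_195 :
  ~ triple_system [:: 195; 160; 28]%N [:: 1; 20; 168]%N 1 3 3 x.
Proof.
move=> H; triple_relations H 3%N; triple_nonneg H 3%N.
krein_relation H [:: 195; 35; -1; -21] [:: 195; 35; -1; -21] [:: 65; -7; 2; -7].
lia.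
Qed.

Lemma no_triple_125 :
  ~ triple_system [:: 125; 108; 24]%N [:: 1; 9; 75]%N 1 1 1 x.
Proof.
move=> H; triple_relations H 3%N; triple_nonneg H 3%N.
krein_relation H [:: 25; 7; 1; -5] [:: 25; 7; 1; -5] [:: 25; 7; 1; -5].
lia.
Qed.

Lemma no_triple_126 :
  ~ triple_system [:: 126; 90; 10]%N [:: 1; 6; 105]%N 1 1 2 x.
Proof.
move=> H; triple_relations H 3%N; triple_nonneg H 3%N.
krein_relation H [:: 180; 50; -2; -15] [:: 126; 9; -4; 35] [:: 126; 9; -4; 35].
lia.
Qed.

Lemma no_triple_203 :
  ~ triple_system [:: 203; 160; 34]%N [:: 1; 16; 170]%N 1 2 2 x.
Proof.
move=> H; triple_relations H 3%N; triple_nonneg H 3%N.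
krein_relation H [:: 203; 43; -1; -17] [:: 203; 43; -1; -17]
  [:: 203; -17; 5; -17].
lia.
Qed.

(* The linear relations alone have no integral solution here; adding the      *)
(* inequalities would only slow [lia] down.                                   *)
Lemma no_triple_53 :
  ~ triple_system [:: 53; 40; 28; 16]%N [:: 1; 4; 10; 28]%N 1 3 4 x.
Proof.
move=> H; triple_relations H 4%N.
krein_relation H [:: 53; 29; 11; -1; -7] [:: 53; 29; 11; -1; -7]
  [:: 742; -14; -14; 13; -14].
krein_relation H [:: 53; 29; 11; -1; -7] [:: 53; 29; 11; -1; -7]
  [:: 424; -56; 16; -8; 7].
(* The previous three columns in another order: the Krein condition is symmetric in them, the
   relation on [x] is not. *)
krein_relation H [:: 53; 29; 11; -1; -7] [:: 424; -56; 16; -8; 7]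
  [:: 53; 29; 11; -1; -7].
krein_relation H [:: 53; 29; 11; -1; -7] [:: 424; -56; 16; -8; 7]
  [:: 265; 55; -8; -5; 10].
lia.
Qed.

End TripleCases.

Theorem theorem4p6 (a : seq nat * seq nat)
  (ha : a \in [:: ([:: 83; 54; 21], [:: 1; 6; 63]);
                  ([:: 104; 70; 25], [:: 1; 7; 80]);
                  ([:: 195; 160; 28], [:: 1; 20; 168]);
                  ([:: 125; 108; 24], [:: 1; 9; 75]);
                  ([:: 126; 90; 10], [:: 1; 6; 105]);
                  ([:: 203; 160; 34], [:: 1; 16; 170]);
                  ([:: 53; 40; 28; 16], [:: 1; 4; 10; 28])]) :
  ~ exists (T : finType) (e : rel T),
      distance_regular e /\ has_intersection_array e a.
Proof.
case=> T [e [dr arr]]; move: ha arr; rewrite !inE.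
do 6?[case/orP]; move=> /eqP-> arr.
- have [||||x] := array_triple_system (A := 1) (B := 1) (C := 2) dr arr;
    by [vm_compute | apply: no_triple_83].
(* The two intersection numbers are a_1 = 33 and b_1 = 70, so this reads 561 <= 420. *)
- have : (17%Z * inum [:: 104; 70; 25] [:: 1; 7; 80] 1 1 1 <=
            6%Z * inum [:: 104; 70; 25] [:: 1; 7; 80] 1 2 1)%R.
    by apply: (array_double_count dr arr _ _ _ triple_111_104 triple_112_104);
      vm_compute.
  by vm_compute.
- have [||||x] := array_triple_system (A := 1) (B := 3) (C := 3) dr arr;
    by [vm_compute | apply: no_triple_195].
- have [||||x] := array_triple_system (A := 1) (B := 1) (C := 1) dr arr;
    by [vm_compute | apply: no_triple_125].
- have [||||x] := array_triple_system (A := 1) (B := 1) (C := 2) dr arr;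
    by [vm_compute | apply: no_triple_126].
- have [||||x] := array_triple_system (A := 1) (B := 2) (C := 2) dr arr;
    by [vm_compute | apply: no_triple_203].
- have [||||x] := array_triple_system (A := 1) (B := 3) (C := 4) dr arr;
    by [vm_compute | apply: no_triple_53].
Qed.
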